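(* Let $1\le k\le n$ be integers and let $A\in\mathcal{M}_n(\mathbb{C})$. Then $$\Lambda_k(A)=\bigcap_{M\in\mathcal{X}_{n-k+1}}F(M^*AM)=\bigcap_{P\in\mathcal{Y}_{n-k+1}}F(PAP).$$
   Context: $\mathcal{M}_n(\mathbb{C})$ is the algebra of $n\times n$ complex matrices and $\mathcal{M}_{n,j}$ the space of $n\times j$ complex matrices. For $1\le j\le n$, $\mathcal{X}_j=\{X\in\mathcal{M}_{n,j}: X^*X=I_j\}$ is the set of $n\times j$ isometries and $\mathcal{Y}_j=\{XX^*: X\in\mathcal{X}_j\}$ is the set of rank-$j$ orthogonal projections of $\mathbb{C}^n$. The $k$-rank numerical range of $A$ is $\Lambda_k(A)=\{\lambda\in\mathbb{C}: X^*AX=\lambda I_k \text{ for some } X\in\mathcal{X}_k\}$ (it may be empty). For a matrix $B\in\mathcal{M}_m(\mathbb{C})$, the numerical range is $F(B)=\{x^*Bx: x\in\mathbb{C}^m,\ x^*x=1\}$. For $P\in\mathcal{Y}_{n-k+1}$, $PAP$ is regarded as the compression of $A$ to the $(n-k+1)$-dimensional range of $P$, so $F(PAP)=\{x^*Ax: x\in\mathbb{C}^n,\ Px=x,\ x^*x=1\}$. *)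

(* Defs.v *)
From mathcomp Require Import all_boot all_order all_algebra.
From mathcomp Require Import classical_sets reals.
From mathcomp Require Export complex.

Set Implicit Arguments.
Unset Strict Implicit.
Unset Printing Implicit Defensive.

Import GRing.Theory Num.Theory.

Local Open Scope ring_scope.
Local Open Scope classical_set_scope.
Local Open Scope sesquilinear_scope.

(* The complex numbers are R[i] with R a model of the real numbers, and      *)
(* X ^t* is the conjugate transpose of X.                                    *)

Section HigherRankNumericalRange.
Variable R : realType.
Local Notation C := R[i].

Definition isometries (n j : nat) : set 'M[C]_(n, j) :=
  [set X | X ^t* *m X = 1%:M].
Arguments isometries : clear implicits.

Definition orthoprojs (n j : nat) : set 'M[C]_n :=
  [set X *m X ^t* | X in isometries n j].

Definition rank_numrange (k n : nat) (A : 'M[C]_n) : set C :=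
  [set lam | exists2 X, isometries n k X & X ^t* *m A *m X = lam%:M].

Definition numrange (m : nat) (B : 'M[C]_m) : set C :=
  [set (x ^t* *m B *m x) 0 0 | x in [set x : 'cV[C]_m | x ^t* *m x = 1%:M]].

(* For an orthogonal projection P, this is F(PAP) with PAP regarded as an    *)
(* operator on the range of P; it is not numrange (P *m A *m P), which may   *)
(* be larger.                                                                *)
Definition compression_numrange (n : nat) (P A : 'M[C]_n) : set C :=
  [set (x ^t* *m A *m x) 0 0 |
     x in [set x : 'cV[C]_n | P *m x = x /\ x ^t* *m x = 1%:M]].

End HigherRankNumericalRange.

Arguments isometries : clear implicits.
Arguments orthoprojs : clear implicits.

(* Main.v *)
Require Import Defs.
From mathcomp Require Import all_boot all_order all_algebra.
From mathcomp Require Import classical_sets reals.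
From mathcomp Require Import boolp zify ring lra.

Set Implicit Arguments.
Unset Strict Implicit.
Unset Printing Implicit Defensive.

Import Order.TTheory GRing.Theory Num.Theory.

Local Open Scope ring_scope.
Local Open Scope sesquilinear_scope.

(** The substance is one inclusion: if lam lies in F(M^*AM) for every isometry M
    with n-k+1 columns, then lam is in the rank-k numerical range.  Replace A
    by A - lam.  Every subspace of dimension n-k+1 then contains a unit vector
    x with x^*Ax = 0, so for no complex w is the Hermitian form
    Re(w x^*Ax) negative definite on a subspace of that dimension
    ([inertia_bound]).  The claim is that such an A has a neutral subspace of
    dimension k, one on which the sesquilinear form of A vanishes identically
    ([neutral_of_inertia]); an orthonormal basis of it gives the isometry that
    is wanted.

    The claim is proved by induction on n.  Suppose first that there is an
    isotropic eigenvector: x <> 0 with x^*Ax = 0 for which Ax and A^*x are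
    proportional.  Then the form passes to the quotient of the orthogonal of x
    by the line of x, which has dimension n-2 (or n-1), and the bound is
    inherited with k-1 in place of k: a negative definite subspace of the
    quotient can be enlarged by one dimension in the original space, because x
    is a null vector that pairs nontrivially with something
    ([negdef_extend_null]).  That argument fails for the w that satisfy
    w + w^* mu = 0, where mu is the eigenvalue; for this reason
    [inertia_bound] carries a finite list of exceptional directions, to which
    each reduction adds one.

    If there is no isotropic eigenvector, then A is invertible, each
    eigenvector of the pencil splits off orthogonally, and A is congruent to a
    diagonal matrix with nonzero entries, no two of them negative multiples of
    each other ([isotropic_eigenvector_or_diag],
    [isotropic_eigenvector_diag_opp]).

    For a diagonal matrix the bound says that a generic open half-plane
    bounded by a line through 0 contains at most n-k, hence at least k, of the
    n entries d_j.  Rotate so that no d_j is on the imaginary axis and sort the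
    entries by the slope t_j of their lines.  As the bounding line turns, the
    number of entries inside minus the number outside changes by 2 at each
    entry, up or down according to the sign of Re d_j, and its absolute value
    stays at most r = n-2k.  A hysteresis rule extracts from the sorted list a
    sublist of odd size 2a+1 with alternating signs such that the excess of the
    remaining entries stays at most r-1 ([extract_alternating]).  After r
    extractions nothing is left, and as n = r + 2k the numbers a add up to k.

    An alternating sublist of size 2a+1 carries a neutral subspace of dimension
    a ([neutral_chain]): the coefficients of the divided difference at the
    nodes t_j alternate in sign and annihilate the polynomials of degree less
    than 2a, so with suitable positive weights w_j the vectors
    (w_j t_j^l)_j, for l < a, are orthogonal for both the real and the
    imaginary part of the diagonal form. *)

(** * Hermitian parts, inertia and neutral subspaces *)

Section Forms.
Variable C : numClosedFieldType.
Implicit Types (m n k : nat).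

Lemma adjmxM m n p (A : 'M[C]_(m, n)) (B : 'M[C]_(n, p)) :
  (A *m B) ^t* = B ^t* *m A ^t*.
Proof. by rewrite trmx_mul map_mxM. Qed.

Lemma adjmxZ m n (a : C) (A : 'M[C]_(m, n)) : (a *: A) ^t* = a^* *: A ^t*.
Proof. by rewrite linearZ map_mxZ. Qed.

Lemma adjmxD m n (A B : 'M[C]_(m, n)) : (A + B) ^t* = A ^t* + B ^t*.
Proof. by rewrite linearD map_mxD. Qed.

Lemma adjmxE m n (A : 'M[C]_(m, n)) i j : (A ^t*) i j = (A j i)^*.
Proof. by rewrite !mxE. Qed.

Lemma adjmx0 m n : (0 : 'M[C]_(m, n)) ^t* = 0.
Proof. by rewrite trmx0 map_mx0. Qed.

Lemma adjmx_eq0 m n (A : 'M[C]_(m, n)) : (A ^t* == 0) = (A == 0).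
Proof. by rewrite map_mx_eq0 trmx_eq0. Qed.

Lemma adjmx_unit n (A : 'M[C]_n) : (A ^t* \in unitmx) = (A \in unitmx).
Proof. by rewrite map_unitmx unitmx_tr. Qed.

Lemma adjcol_mx m1 m2 n (A : 'M[C]_(m1, n)) (B : 'M[C]_(m2, n)) :
  (col_mx A B) ^t* = row_mx (A ^t*) (B ^t*).
Proof. by rewrite tr_col_mx map_row_mx. Qed.

Lemma congr_col_mx m1 m2 n (A : 'M[C]_n) (X : 'M[C]_(m1, n)) (Y : 'M[C]_(m2, n)) :
  col_mx X Y *m A *m (col_mx X Y) ^t* =
  block_mx (X *m A *m X ^t*) (X *m A *m Y ^t*)
           (Y *m A *m X ^t*) (Y *m A *m Y ^t*).
Proof. by rewrite adjcol_mx mul_col_mx mul_col_row. Qed.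

Lemma mul_adj_eq0 n (x : 'rV[C]_n) : (x *m x ^t* == 0) = (x == 0).
Proof.
apply/eqP/eqP => [x0|->]; last by rewrite mul0mx.
apply/eqP; apply: contraT => /dotmx_is_dotmx.
by rewrite dotmxE x0 mxE ltxx.
Qed.

(** Twice the Hermitian part of [w *: A].  Vectors are rows here, and the form
    of [A] sends [u] and [v] to [u *m A *m v ^t*]. *)
Definition hpart (w : C) n (A : 'M[C]_n) := w *: A + w^* *: A ^t*.

Definition negdef m n (H : 'M[C]_n) (U : 'M[C]_(m, n)) :=
  forall u : 'rV_m, u != 0 -> (u *m U *m H *m (u *m U) ^t*) 0 0 < 0.

(** The forms [hpart w A] have at most [n - k] negative squares.  The list [B]
    excludes finitely many real lines of values [w], because the passage to a
    quotient loses the bound on one such line. *)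
Definition inertia_bound (B : seq C) n (A : 'M[C]_n) k :=
  forall w, w != 0 -> (forall b, b \in B -> w + w^* * b != 0) ->
  forall m (U : 'M[C]_(m, n)), negdef (hpart w A) U -> (m + k <= n)%N.

Definition neutral n (A : 'M[C]_n) m (X : 'M[C]_(m, n)) :=
  row_free X /\ X *m A *m X ^t* = 0.

(** An eigenvector of the pencil of [A] and [A ^t*] on which the form of [A]
    vanishes. *)
Definition isotropic_eigenvector n (A : 'M[C]_n) (x : 'rV[C]_n) (mu : C) :=
  [/\ x != 0, x *m A *m x ^t* = 0 & x *m A ^t* = mu *: (x *m A)].

Lemma hpart_congr w m n (A : 'M[C]_n) (P : 'M[C]_(m, n)) :
  hpart w (P *m A *m P ^t*) = P *m hpart w A *m P ^t*.
Proof.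
rewrite /hpart !adjmxM trmxCK mulmxDr mulmxDl -!scalemxAr -!scalemxAl.
by rewrite !mulmxA.
Qed.

Lemma hpart_adj w n (A : 'M[C]_n) : (hpart w A) ^t* = hpart w A.
Proof. by rewrite /hpart adjmxD !adjmxZ trmxCK conjCK addrC. Qed.

Lemma hpartZ w a n (A : 'M[C]_n) : hpart w (a *: A) = hpart (w * a) A.
Proof. by rewrite /hpart adjmxZ !scalerA rmorphM. Qed.

Lemma negdef_congr m1 m n (H : 'M[C]_n) (P : 'M[C]_(m, n)) (U : 'M[C]_(m1, m)) :
  negdef (P *m H *m P ^t*) U <-> negdef H (U *m P).
Proof. by split=> h u /h; rewrite !adjmxM !mulmxA. Qed.

(** [hpart w (w0 *: A) = hpart (w * w0) A], so multiplication by [w0] rotates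
    the exceptional directions. *)
Lemma inertia_bound_compression B w0 m n (A : 'M[C]_n) (P : 'M[C]_(m, n)) k :
  inertia_bound B A k -> w0 != 0 -> (n <= m)%N ->
  inertia_bound [seq w0^* / w0 * b | b <- B] (w0 *: (P *m A *m P ^t*)) k.
Proof.
move=> QA w00 nm w wn0 wB m1 U Un.
have := QA (w * w0) _ _ m1 (U *m P); rewrite mulf_neq0 // => /(_ isT) h.
have /h : forall b, b \in B -> w * w0 + (w * w0)^* * b != 0.
  move=> b bB; have /wB := map_f (fun b => w0^* / w0 * b) bB.
  apply: contraNneq => e; apply/eqP/(mulfI w00); rewrite mulr0 -[RHS]e rmorphM /=.
  by field.
move=> {}h; apply: leq_trans nm; apply: h.
by move: Un; rewrite hpartZ hpart_congr => /negdef_congr.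
Qed.

Lemma neutral_congr m n (A : 'M[C]_n) (P : 'M[C]_(m, n)) k (X : 'M[C]_(k, m)) :
  row_free P -> neutral (P *m A *m P ^t*) X -> neutral A (X *m P).
Proof.
move=> Pf [Xf X0]; split; first by rewrite /row_free mxrankMfree.
by rewrite adjmxM -X0 !mulmxA.
Qed.

Lemma row_free_col_mx m n (x : 'rV[C]_n) (W : 'M[C]_(m, n)) (c : 'cV[C]_n) :
  x *m c != 0 -> W *m c = 0 -> row_free W -> row_free (col_mx x W).
Proof.
move=> xc Wc Wf; apply: inj_row_free => v.
rewrite -[v]hsubmxK mul_row_col => e.
have : (lsubmx v *m x + rsubmx v *m W) *m c = 0 by rewrite e mul0mx.
rewrite mulmxDl -!mulmxA Wc mulmx0 addr0.
rewrite [lsubmx v]mx11_scalar mul_scalar_mx => /eqP.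
rewrite scaler_eq0 (negPf xc) orbF => /eqP v0.
have {}v0 : lsubmx v = 0 by rewrite [lsubmx v]mx11_scalar v0 raddf0.
move: e; rewrite v0 mul0mx add0r => e.
have -> : rsubmx v = 0 by apply: (row_free_inj Wf); rewrite e mul0mx.
by rewrite mxE raddf0 row_mx0.
Qed.

Lemma complement_line n (c : 'cV[C]_n) : c != 0 ->
  exists m (W : 'M[C]_(m, n)), [/\ (m + 1)%N = n, row_free W & W *m c = 0].
Proof.
move=> c0; exists (\rank (kermx c)), (row_base (kermx c)); split.
- by rewrite mxrank_ker; have := rank_leq_row c; have: \rank c = 1%N;
    [apply/eqP; rewrite eqn_leq rank_leq_col lt0n mxrank_eq0 | lia].
- exact: row_base_free.
- by apply/sub_kermxP; rewrite eq_row_base.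
Qed.

(** A complement of the line of [x] inside the hyperplane [c], which contains
    [x]; it represents the quotient of the hyperplane by that line. *)
Lemma complement_in_hyperplane n (x : 'rV[C]_n) (c : 'cV[C]_n) :
  x != 0 -> c != 0 -> x *m c = 0 ->
  exists m (W : 'M[C]_(m, n)),
    [/\ (m + 2)%N = n, row_free (col_mx x W) & W *m c = 0].
Proof.
move=> x0 c0 xc.
have ax0 : x ^t* != 0 by rewrite adjmx_eq0.
have [m [W [mn Wf Wx]]] := complement_line ax0.
have Wc : W *m c != 0.
  apply: contraNneq c0 => Wc.
  have xWf : row_free (col_mx x W).
    by apply: (row_free_col_mx _ Wx Wf); rewrite mul_adj_eq0.
  have : row_full (col_mx x W) by rewrite /row_full (eqP xWf) addnC mn.
  move=> xWF; apply/eqP/(row_full_inj xWF); rewrite mulmx0 mul_col_mx xc Wc.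
  by rewrite col_mx0.
have [m' [W' [m'm W'f W'W]]] := complement_line Wc.
exists m', (W' *m W); split; first lia.
  apply: (@row_free_col_mx _ _ _ _ (x ^t*)); first by rewrite mul_adj_eq0.
    by rewrite -mulmxA Wx mulmx0.
  by rewrite /row_free mxrankMfree.
by rewrite -mulmxA.
Qed.

Lemma negdef_row_free m n (H : 'M[C]_n) (U : 'M[C]_(m, n)) :
  negdef H U -> row_free (U *m H *m U ^t*).
Proof.
move=> Un; apply: inj_row_free => u uU; apply/eqP; apply: contraT => /Un.
suff -> : u *m U *m H *m (u *m U) ^t* = 0 by rewrite mxE ltxx.
by rewrite adjmxM mulmxA -[u *m U *m H]mulmxA -[u *m _ *m _]mulmxA uU mul0mx.
Qed.

Lemma negdef_extend m n (H : 'M[C]_n) (U : 'M[C]_(m, n)) (z : 'rV[C]_n) :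
  H ^t* = H -> negdef H U -> U *m H *m z ^t* = 0 ->
  (z *m H *m z ^t*) 0 0 < 0 -> negdef H (col_mx U z).
Proof.
move=> Hh Un Uz zn u u0.
have zU : z *m H *m U ^t* = 0.
  by apply/eqP; rewrite -adjmx_eq0 !adjmxM trmxCK Hh mulmxA Uz.
rewrite -[u]hsubmxK mul_row_col.
set a : 'rV_m := lsubmx u; set b : 'M_1 := rsubmx u.
have -> : ((a *m U + b *m z) *m H *m (a *m U + b *m z)^t*) =
    a *m U *m H *m (a *m U)^t* + b *m (z *m H *m z ^t*) *m b ^t*.
  have aUz : a *m U *m H *m (b *m z) ^t* = 0.
    rewrite adjmxM mulmxA -[a *m U *m H]mulmxA -[a *m _ *m z ^t*]mulmxA Uz.
    by rewrite mulmx0 mul0mx.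
  have bzU : b *m z *m H *m (a *m U) ^t* = 0.
    rewrite adjmxM mulmxA -[b *m z *m H]mulmxA -[b *m _ *m U ^t*]mulmxA zU.
    by rewrite mulmx0 mul0mx.
  rewrite adjmxD !mulmxDl !mulmxDr aUz bzU addr0 add0r.
  by rewrite [(b *m z) ^t*]adjmxM !mulmxA.
rewrite mxE [b]mx11_scalar [z *m H *m z^t*]mx11_scalar.
rewrite tr_scalar_mx map_scalar_mx -!scalar_mxM [X in _ + X]mxE eqxx mulr1n.
rewrite mulrAC -normCK.
have [b0|b0] := eqVneq (b 0 0) 0.
  rewrite b0 normr0 expr0n mul0r addr0; apply: Un; apply: contraNneq u0 => a0.
  by rewrite -[u]hsubmxK -/a -/b a0 [b]mx11_scalar b0 raddf0 row_mx0.
apply: ltr_wnDl; last by rewrite pmulr_rlt0 // exprn_gt0 // normr_gt0.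
have [->|/Un/ltW//] := eqVneq a 0.
by rewrite !mul0mx mxE.
Qed.

(** The rows of [V] and the null vector [x] are H-orthogonal, and some vector
    pairs nontrivially with [x], namely [y] itself.  Remove from [y] its
    H-projection on the rows of [V] to get [z]; since [x] is null, adding
    multiples of [x] to [z] changes the value of the form at [z] at will while
    [z] stays H-orthogonal to [V]. *)
Lemma negdef_extend_null m n (H : 'M[C]_n) (V : 'M[C]_(m, n))
    (x y : 'rV[C]_n) g :
  H ^t* = H -> negdef H V -> x *m H = g *: y -> g != 0 -> y != 0 ->
  y *m x ^t* = 0 -> V *m y ^t* = 0 ->
  exists z : 'rV[C]_n, negdef H (col_mx V z).
Proof.
move=> Hh Vn xH g0 y0 yx Vy.
have VHx : V *m H *m x ^t* = 0.
  by rewrite -mulmxA -{1}Hh -adjmxM xH adjmxZ -scalemxAr Vy scaler0.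
have xHx : x *m H *m x ^t* = 0 by rewrite xH -scalemxAl yx scaler0.
have Gu : V *m H *m V ^t* \in unitmx.
  by rewrite -row_free_unit; apply: negdef_row_free.
set G := V *m H *m V ^t* in Gu.
pose z := y - y *m H *m V ^t* *m invmx G *m V.
have zHV : z *m H *m V ^t* = 0.
  rewrite /z !mulmxBl -[_ *m V *m H]mulmxA -[_ *m (V *m H) *m _]mulmxA -/G.
  by rewrite mulmxKV // subrr.
have VHz : V *m H *m z ^t* = 0.
  by apply/eqP; rewrite -adjmx_eq0 !adjmxM trmxCK Hh mulmxA zHV.
have zy : z *m y ^t* = y *m y ^t*.
  by rewrite /z mulmxBl -[_ *m V *m _]mulmxA Vy mulmx0 subr0.
have yz : y *m z ^t* = y *m y ^t*.
  by rewrite -[LHS]trmxCK adjmxM trmxCK zy adjmxM trmxCK.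
clearbody z.
pose N := (y *m y ^t*) 0 0.
have N0 : N != 0.
  move: y0; rewrite -mul_adj_eq0; apply: contraNneq => N0.
  by rewrite [y *m _]mx11_scalar -/N N0 raddf0.
have Nr : N^* = N.
  have <- : ((y *m y ^t*) ^t*) 0 0 = N^* by rewrite adjmxE.
  by rewrite adjmxM trmxCK.
pose q := (z *m H *m z ^t*) 0 0.
have qr : q^* = q.
  have <- : ((z *m H *m z ^t*) ^t*) 0 0 = q^* by rewrite adjmxE.
  by rewrite !adjmxM trmxCK Hh mulmxA.
(* chosen so that the form takes the value -1 at z + c x *)
pose c := - (q + 1) / (2 * g * N).
pose z' := z + c *: x.
have VHz' : V *m H *m z' ^t* = 0.
  by rewrite adjmxD adjmxZ mulmxDr -scalemxAr VHz VHx scaler0 addr0.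
have z'n : (z' *m H *m z' ^t*) 0 0 < 0.
  have xHz : x *m H *m z ^t* = (g * N)%:M.
    by rewrite xH -scalemxAl yz [y *m _]mx11_scalar -/N scale_scalar_mx.
  have zHx : z *m H *m x ^t* = (g * N)^*%:M.
    have -> : z *m H *m x ^t* = (x *m H *m z ^t*) ^t*.
      by rewrite !adjmxM trmxCK Hh mulmxA.
    by rewrite xHz tr_scalar_mx map_scalar_mx.
  rewrite /z' adjmxD adjmxZ !mulmxDl !mulmxDr -!scalemxAr -!scalemxAl.
  rewrite xHz zHx xHx !scaler0 addr0 [z *m H *m _]mx11_scalar -/q.
  rewrite !scale_scalar_mx -!raddfD /= !mxE eqxx mulr1n.
  have -> : q + c^* * (g * N)^* + c * (g * N) = -1.
    rewrite /c !rmorphM fmorphV !rmorphM rmorphN rmorphD rmorph1.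
    rewrite rmorph_nat /= qr Nr.
    have gs0 : g^* != 0 by rewrite conjC_eq0.
    by field; rewrite N0 g0 gs0.
  by rewrite ltrN10.
by exists z'; apply: negdef_extend.
Qed.

(** The rows of [W] span a copy of the quotient of the orthogonal of [x] by the
    line of [x].  For the [w] with [w + w^* * mu != 0] the vector [x] is not in
    the kernel of [hpart w A], and a negative definite subspace of the quotient
    gains a dimension. *)
Lemma inertia_bound_reduction B n (A : 'M[C]_n) k x mu m (W : 'M[C]_(m, n)) :
  inertia_bound B A k.+1 -> isotropic_eigenvector A x mu -> x *m A != 0 ->
  (m + 2)%N = n -> W *m (x *m A) ^t* = 0 ->
  inertia_bound (mu :: B) (W *m A *m W ^t*) k.
Proof.
move=> QA [x0 xAx xAs] y0 mn Wy w w0 wB p U.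
rewrite hpart_congr => /negdef_congr Un.
have g0 : w + w^* * mu != 0 by apply: wB; rewrite inE eqxx.
have xH : x *m hpart w A = (w + w^* * mu) *: (x *m A).
  by rewrite /hpart mulmxDr -!scalemxAr xAs scalerA -scalerDl.
have Vy : U *m W *m (x *m A) ^t* = 0 by rewrite -mulmxA Wy mulmx0.
have [z zn] := negdef_extend_null (hpart_adj w A) Un xH g0 y0 xAx Vy.
have wB' b : b \in B -> w + w^* * b != 0.
  by move=> bB; apply: wB; rewrite inE bB orbT.
by have := QA _ w0 wB' _ _ zn; lia.
Qed.

Lemma neutral_extend m n k (A : 'M[C]_n) (x : 'rV[C]_n) (W : 'M[C]_(m, n)) X :
  row_free (col_mx x W) -> x *m A *m x ^t* = 0 ->
  x *m A *m W ^t* = 0 -> W *m A *m x ^t* = 0 ->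
  neutral (W *m A *m W ^t*) X ->
  neutral A (col_mx x (X *m W : 'M_(k, n))).
Proof.
move=> Wf xx xW Wx [Xf X0]; split.
  have -> : col_mx x (X *m W) = block_mx (1%:M : 'M_1) 0 0 X *m col_mx x W.
    by rewrite mul_block_col mul1mx !mul0mx addr0 add0r.
  rewrite /row_free mxrankMfree //; apply: inj_row_free => v.
  rewrite -[v]hsubmxK mul_row_block mulmx1 !mulmx0 addr0 add0r.
  rewrite -row_mx0 => /eq_row_mx [-> e].
  have -> : rsubmx v = 0 by apply: (row_free_inj Xf); rewrite e mul0mx.
  by rewrite row_mx0.
rewrite congr_col_mx xx adjmxM !mulmxA xW mul0mx.
rewrite -[X *m W *m A]mulmxA -[X *m (W *m A) *m _]mulmxA Wx mulmx0.
rewrite -[X *m _ *m W^t* *m _]mulmxA in X0 *.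
by move: X0; rewrite !mulmxA => ->; rewrite block_mx0.
Qed.

(** * Diagonalization and quotients by isotropic eigenvectors *)

(** A kernel vector of [A ^t*] is automatically isotropic. *)
Lemma isotropic_eigenvector_singular n (A : 'M[C]_n) :
  A \notin unitmx -> exists x, isotropic_eigenvector A x 0.
Proof.
move=> Au.
have : kermx (A ^t*) != 0.
  by rewrite kermx_eq0 row_free_unit adjmx_unit.
move=> /rowV0Pn[x /sub_kermxP xA x0]; exists x; split=> //.
  by apply/eqP; rewrite -adjmx_eq0 !adjmxM trmxCK mulmxA xA mul0mx.
by rewrite scale0r.
Qed.

Lemma isotropic_eigenvector_congr n (A P : 'M[C]_n) x mu : row_free P ->
  isotropic_eigenvector (P *m A *m P ^t*) x mu ->
  isotropic_eigenvector A (x *m P) mu.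
Proof.
move=> Pf [x0 xx xe]; split.
- by rewrite mulmx_free_eq0.
- by rewrite adjmxM -xx !mulmxA.
- have Pu : P ^t* \in unitmx by rewrite adjmx_unit -row_free_unit.
  apply: (can_inj (mulmxK Pu)); move: xe.
  by rewrite -scalemxAl !adjmxM trmxCK !mulmxA.
Qed.

(** For invertible [A] take an eigenvector [x] of [A ^t* *m invmx A].  If [x] is
    not isotropic, its left and right orthogonals for [A] are the same
    hyperplane, which complements [x]; induction applies to the compression of
    [A] to that hyperplane. *)
Lemma isotropic_eigenvector_or_diag n (A : 'M[C]_n) :
  (exists x mu, isotropic_eigenvector A x mu) \/
  exists (P : 'M[C]_n) d, row_free P /\ P *m A *m P ^t* = diag_mx d.
Proof.
elim: n A => [|n IHn] A.
  right; exists 1%:M, 0; split; first by rewrite row_free_unit unitmx1.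
  by apply/matrixP => -[].
have [Au|/isotropic_eigenvector_singular[x xA]] := boolP (A \in unitmx);
    last first.
  by left; exists x, 0.
have [a] := @eigenvalue_closed C n.+1 (A ^t* *m invmx A) isT.
move=> /eigenvalueP[x xe x0].
have {}xe : x *m A ^t* = a *: (x *m A).
  by rewrite scalemxAl -xe mulmxA mulmxKV.
have a0 : a != 0.
  apply: contraNneq x0 => a0; move: xe; rewrite a0 scale0r.
  have Asu : A ^t* \in unitmx by rewrite adjmx_unit.
  by move=> /(congr1 (mulmx^~ (invmx (A ^t*)))); rewrite mulmxK // mul0mx => ->.
have [q0|q0] := eqVneq (x *m A *m x ^t*) 0; first by left; exists x, a.
have c0 : A *m x ^t* != 0.
  by apply: contraNneq q0 => c0; rewrite -mulmxA c0 mulmx0.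
have [m [W [mn Wf Wc]]] := complement_line c0.
have {}mn : m = n by lia.
subst m.
have WAx : W *m A *m x ^t* = 0 by rewrite -mulmxA.
have xAW : x *m A *m W ^t* = 0.
  have : x *m A ^t* *m W ^t* = 0.
    by apply/eqP; rewrite -adjmx_eq0 !adjmxM !trmxCK mulmxA WAx.
  by rewrite xe -scalemxAl => /eqP; rewrite scaler_eq0 (negPf a0) => /eqP.
have [[v [mu [v0 vv ve]]]|[P [d [Pf Pd]]]] := IHn (W *m A *m W ^t*).
  left; exists (v *m W), mu; split.
  - by rewrite mulmx_free_eq0.
  - by rewrite adjmxM -vv !mulmxA.
  pose Q : 'M_(1 + n) := col_mx x W.
  have Qf : row_free Q by apply: (row_free_col_mx _ Wc Wf); rewrite mulmxA.
  have Qu : Q ^t* \in unitmx by rewrite adjmx_unit -row_free_unit.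
  apply: (can_inj (mulmxK Qu)).
  rewrite /Q adjcol_mx !mul_mx_row -!scalemxAl; congr row_mx.
    rewrite -[v *m W *m A]mulmxA -[v *m _ *m x^t*]mulmxA WAx mulmx0 scaler0.
    apply/eqP; rewrite -adjmx_eq0 !adjmxM !trmxCK !mulmxA.
    by rewrite xAW mul0mx.
  by move: ve; rewrite !adjmxM trmxCK !mulmxA.
right; exists (col_mx x (P *m W) : 'M_(1 + n)).
exists (row_mx (x *m A *m x ^t*) d : 'rV_(1 + n)).
split.
  apply: (row_free_col_mx (c := A *m x ^t*)); first by rewrite mulmxA.
    by rewrite -mulmxA Wc mulmx0.
  by rewrite /row_free mxrankMfree.
apply: etrans (congr_col_mx A x (P *m W)) _.
apply: etrans _ (esym (diag_mx_row _ _)).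
rewrite -Pd adjmxM !mulmxA xAW mul0mx.
congr block_mx.
  by apply/matrixP=> i j; rewrite !ord1 !mxE eqxx mulr1n.
by rewrite -!mulmxA [W *m _]mulmxA WAx mulmx0.
Qed.

(** A neutral subspace of the quotient lifts to one that contains [x].  When
    [x *m A = 0] the quotient is by the radical vector [x] and loses only one
    dimension. *)
Lemma neutral_reduction B n (A : 'M[C]_n) k x mu :
  inertia_bound B A k.+1 -> isotropic_eigenvector A x mu ->
  (forall m, (m < n)%N -> forall (A' : 'M[C]_m) B', inertia_bound B' A' k ->
     exists X : 'M[C]_(k, m), neutral A' X) ->
  exists X : 'M[C]_(k.+1, n), neutral A X.
Proof.
move=> QA xA IH; have [x0 xx xe] := xA.
have [y0|y0] := eqVneq (x *m A) 0.
  have ax0 : x ^t* != 0 by rewrite adjmx_eq0.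
  have [m [W [mn Wf Wx]]] := complement_line ax0.
  have [||X Xn] := IH m _ (W *m A *m W ^t*) B; first by lia.
    move=> w w0 wB p U; rewrite hpart_congr => /negdef_congr Un.
    by have := QA w w0 wB _ _ Un; lia.
  exists (col_mx x (X *m W)); apply: neutral_extend => //.
  - by apply: (row_free_col_mx _ Wx Wf); rewrite mul_adj_eq0.
  - by rewrite y0 mul0mx.
  - apply/eqP; rewrite -adjmx_eq0 !adjmxM !trmxCK mulmxA xe y0.
    by rewrite scaler0 mul0mx.
have ay0 : (x *m A) ^t* != 0 by rewrite adjmx_eq0.
have xy : x *m (x *m A) ^t* = 0.
  by rewrite adjmxM mulmxA xe -scalemxAl xx scaler0.
have [m [W [mn Wf Wy]]] := complement_in_hyperplane x0 ay0 xy.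
have [||X Xn] := IH m _ (W *m A *m W ^t*) (mu :: B); first by lia.
  exact: (inertia_bound_reduction QA xA).
exists (col_mx x (X *m W)); apply: neutral_extend => //.
  by rewrite -[LHS]trmxCK adjmxM trmxCK Wy adjmx0.
apply/eqP; rewrite -adjmx_eq0 !adjmxM !trmxCK mulmxA xe -scalemxAl scaler_eq0.
by rewrite -adjmx_eq0 adjmxM trmxCK Wy eqxx orbT.
Qed.

Lemma isotropic_eigenvector_diag0 n (d : 'rV[C]_n) i :
  d 0 i = 0 -> isotropic_eigenvector (diag_mx d) (delta_mx 0 i) 0.
Proof.
move=> di.
have e0 : delta_mx 0 i *m diag_mx d = 0 :> 'rV_n.
  rewrite mul_mx_diag; apply/matrixP => a b; rewrite !mxE ord1 eqxx /=.
  by case: eqP => [->|]; rewrite ?di ?mulr0 ?mul0r.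
split; last 1 first.
- rewrite scale0r tr_diag_mx map_diag_mx mul_mx_diag; apply/matrixP => a b.
  rewrite !mxE ord1 eqxx /=.
  by case: eqP => [->|]; rewrite ?di ?conjC0 ?mulr0 ?mul0r.
- apply/eqP => /matrixP/(_ 0 i); rewrite !mxE !eqxx => /eqP.
  by rewrite oner_eq0.
- by rewrite e0 mul0mx.
Qed.

(** With [d 0 i = - s ^+ 2 * d 0 j], the vector [e_i + s e_j] is isotropic; it is
    an eigenvector because [d 0 i] and [d 0 j] lie on the same real line. *)
Lemma isotropic_eigenvector_diag_opp n (d : 'rV[C]_n) i j :
  d 0 i / d 0 j < 0 -> exists x mu, isotropic_eigenvector (diag_mx d) x mu.
Proof.
move=> dij.
have ij : i != j.
  apply: contraTneq dij => ->; have [->|/divff->] := eqVneq (d 0 j) 0.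
    by rewrite mul0r ltxx.
  by rewrite ltr10.
have dj0 : d 0 j != 0.
  by apply: contraTneq dij => ->; rewrite invr0 mulr0 ltxx.
have di0 : d 0 i != 0.
  by apply: contraTneq dij => ->; rewrite mul0r ltxx.
set r := d 0 i / d 0 j in dij.
have di : d 0 i = r * d 0 j by rewrite /r mulfVK.
have rr : r^* = r by apply/CrealP; rewrite realE (ltW dij) orbT.
pose s := sqrtC (- r).
have s0 : 0 < s by rewrite sqrtC_gt0 oppr_gt0.
have ss : s ^+ 2 = - r by rewrite sqrtCK.
have sr : s^* = s by apply/CrealP; rewrite realE (ltW s0).
pose x : 'rV[C]_n := delta_mx 0 i + s *: delta_mx 0 j.
have xi : x 0 i = 1 by rewrite !mxE !eqxx (negPf ij) mulr0 addr0.
have xj : x 0 j = s by rewrite !mxE !eqxx [j == i]eq_sym (negPf ij) mulr1 add0r.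
have xl l : l != i -> l != j -> x 0 l = 0.
  by move=> li lj; rewrite !mxE (negPf li) (negPf lj) mulr0 addr0.
exists x, ((d 0 i)^* / d 0 i); split.
- by apply/eqP => x0; move: xi; rewrite x0 mxE => /eqP; rewrite eq_sym oner_eq0.
- apply/matrixP=> a b; rewrite !ord1 mul_mx_diag !mxE.
  rewrite (bigD1 i) // (bigD1 j) 1?eq_sym //=.
  rewrite big1 => [|l /andP[li lj]].
    rewrite !adjmxE !mxE; move: xi xj; rewrite !mxE => -> ->.
    by rewrite conjC1 mulr1 mul1r sr mulrAC -expr2 ss di; ring.
  by rewrite mxE; move: (xl l li lj); rewrite mxE => ->; rewrite !mul0r.
- rewrite tr_diag_mx map_diag_mx !mul_mx_diag; apply/matrixP => a l.
  rewrite ord1 mxE [RHS]mxE [X in _ = _ * X]mxE [X in _ * X = _]mxE.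
  have [->|li] := eqVneq l i; first by rewrite xi !mul1r mulfVK.
  have [->|lj] := eqVneq l j; last by rewrite xl // !mul0r mulr0.
  rewrite di rmorphM /= rr mulrCA; congr (_ * _).
  have r0 : r != 0 by rewrite ltr0_neq0.
  by field; rewrite r0 dj0.
Qed.

(** The coordinate vectors of the entries in an open half-plane span a negative
    definite subspace. *)
Lemma inertia_bound_diag B n (d : 'rV[C]_n) k w :
  inertia_bound B (diag_mx d) k -> w != 0 ->
  (forall b, b \in B -> w + w^* * b != 0) ->
  (#|[set j : 'I_n | (w * d 0 j + (w * d 0 j)^* < 0)%R]| + k <= n)%N.
Proof.
move=> QD w0 wB; set S := [set j : 'I_n | _].
pose f : 'I_#|S| -> 'I_n := enum_val.
apply: (QD w w0 wB _ (rowsub f 1%:M)) => u u0.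
pose h : 'rV[C]_n := \row_j (w * d 0 j + (w * d 0 j)^*).
have -> : hpart w (diag_mx d) = diag_mx h.
  rewrite /hpart tr_diag_mx map_diag_mx; apply/matrixP => i j.
  rewrite !mxE rmorphM /=; case: eqP => [->|_]; first by rewrite !mulr1n.
  by rewrite !mulr0n !mulr0 addr0.
have -> : u *m rowsub f 1%:M *m diag_mx h *m (u *m rowsub f 1%:M) ^t* =
          u *m diag_mx (\row_i h 0 (f i)) *m u ^t*.
  rewrite adjmxM !mulmxA; congr (_ *m _); rewrite -!mulmxA; congr (_ *m _).
  rewrite mulmxA mul_rowsub_mx mul1mx.
  apply/matrixP => i j; rewrite mxE (bigD1 (f j)) //= big1 => [|l lj].
    by rewrite !mxE eqxx conjC1 mulr1 addr0 (inj_eq enum_val_inj).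
  by rewrite !mxE [f j == l]eq_sym (negPf lj) conjC0 mulr0.
have [i ui] : exists i, u 0 i != 0.
  apply/existsP; apply: contraNT u0; rewrite negb_exists => /forallP u0.
  by apply/eqP/rowP => i; rewrite mxE; apply/eqP; rewrite -[_ == _]negbK u0.
have hf i' : h 0 (f i') < 0.
  by have := enum_valP i'; rewrite inE !mxE.
have le0 i' : (u *m diag_mx (\row_i h 0 (f i))) 0 i' * (u ^t*) i' 0 =
              h 0 (f i') * `|u 0 i'| ^+ 2.
  by rewrite mul_mx_diag mxE adjmxE [(\row_ _ _) 0 _]mxE mulrAC -normCK mulrC.
rewrite mxE (bigD1 i) //= le0 ltr_nwDl //.
  by rewrite pmulr_llt0 // exprn_gt0 // normr_gt0.
by apply: sumr_le0 => i' _; rewrite le0 nmulr_rle0 // exprn_ge0.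
Qed.

Lemma negdef_free m n (H : 'M[C]_n) (U : 'M[C]_(m, n)) : negdef H U -> row_free U.
Proof.
move=> Un; apply: inj_row_free => u uU; apply/eqP; apply: contraT => /Un.
by rewrite uU !mul0mx mxE ltxx.
Qed.

Lemma hpart_neutral w n (A : 'M[C]_n) (u : 'rV[C]_n) :
  u *m A *m u ^t* = 0 -> u *m hpart w A *m u ^t* = 0.
Proof. by rewrite -hpart_congr /hpart => ->; rewrite adjmx0 !scaler0 addr0. Qed.

Lemma exists_unit n (v : 'rV[C]_n) : v != 0 ->
  exists c : C, (c *: v) *m (c *: v) ^t* = 1%:M.
Proof.
move=> v0; have := dotmx_is_dotmx v0; rewrite dotmxE; set N := _ 0 0 => N0.
have vv : v *m v ^t* = N%:M by rewrite [LHS]mx11_scalar.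
pose s := sqrtC N; have s0 : 0 < s by rewrite sqrtC_gt0.
exists s^-1; rewrite adjmxZ -scalemxAr -scalemxAl vv scalerA scale_scalar_mx.
rewrite conj_Creal ?rpredV ?gtr0_real // -expr2 exprVn sqrtCK mulVf //.
by rewrite gt_eqF.
Qed.

End Forms.

(** * Extraction of alternating subsequences by hysteresis *)

Section Hysteresis.
Variables (I : eqType) (s : I -> bool).
Implicit Types (l c : seq I) (r h : int) (b : bool).

Definition step (b : bool) : int := if b then 1 else -1.

(** For a list sorted by slope and cut as [l1 ++ l2], the difference
    [drift l1 - drift l2] is the number of entries inside minus the number
    outside of a half-plane whose boundary passes between [l1] and [l2]. *)
Definition drift l : int := \sum_(x <- l) step (s x).

(** The walk that starts at [h] and moves by [2 * step] stays in [[-r, r]].  It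
    follows [drift l1 - drift l2] along the cuts of [l] when [h = - drift l]. *)
Fixpoint confined r h l :=
  (`|h| <= r) &&
  (if l is x :: l' then confined r (h + 2 * step (s x)) l' else true).

Lemma confined_head r h l : confined r h l -> `|h| <= r.
Proof. by case: l => [|x l] /= /andP[]. Qed.

Fixpoint alternating b l :=
  if l is x :: l' then (s x == b) && alternating (~~ b) l' else true.

(** A two-state automaton with hysteresis: it keeps its state except at the
    extreme heights [r] and [- r], which force the states [true] and [false]. *)
Definition switch r (b : bool) h :=
  if h == r then true else if h == - r then false else b.

Fixpoint final_state r h b l :=
  if l is x :: l' then
    let h' := h + 2 * step (s x) in final_state r h' (switch r b h') l'
  else b.

Lemma drift_cons x l : drift (x :: l) = step (s x) + drift l.
Proof. by rewrite /drift big_cons. Qed.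

Lemma drift_cat l1 l2 : drift (l1 ++ l2) = drift l1 + drift l2.
Proof. by rewrite /drift big_cat. Qed.

Lemma drift_perm l1 l2 : perm_eq l1 l2 -> drift l1 = drift l2.
Proof. exact: perm_big. Qed.

Lemma drift_count l : drift l = (count s l)%:Z - (count (predC s) l)%:Z.
Proof.
elim: l => [|x l IHl]; first by rewrite /drift big_nil.
by rewrite drift_cons IHl /=; case: (s x) => /=; lia.
Qed.

Lemma drift_alternating b l : odd (size l) -> alternating b l -> drift l = step b.
Proof.
move: {2}(size l) (leqnn (size l)) => m.
elim: m b l => [|m IHm] b [|x [|y l]] //= lm.
  by move=> _ /andP[/eqP sx _]; rewrite drift_cons /drift big_nil sx addr0.
rewrite negbK => lo /and3P[/eqP sx /eqP sy]; rewrite negbK => /IHm e.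
rewrite !drift_cons e //; last by lia.
by rewrite sx sy; case: b {IHm sx sy e}; rewrite /step /=; lia.
Qed.

Lemma confined_prefix r h l :
  (forall l1 l2, l = l1 ++ l2 -> `|h + 2 * drift l1| <= r) -> confined r h l.
Proof.
elim: l h => [|x l IHl] h H /=; have := H [::] _ erefl.
  by rewrite /drift big_nil mulr0 addr0 andbT.
rewrite /drift big_nil mulr0 addr0 => -> /=; apply: IHl => l1 l2 e.
by have := H (x :: l1) l2; rewrite e drift_cons mulrDr addrA; apply.
Qed.

Lemma confined_shift r h e l :
  `|e| <= 1 -> confined r h l -> confined (r + 1) (h + e) l.
Proof.
move=> e1; elim: l h => [|x l IHl] h /= /andP[hr hl];
  apply/andP; split=> //; [lia|lia|].
by rewrite addrAC; apply: IHl.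
Qed.

Lemma final_state_end r h b l : 0 < r ->
  (h = r -> b) -> (h = - r -> ~~ b) ->
  let h' := h + 2 * drift l in
  (h' = r -> final_state r h b l) /\ (h' = - r -> ~~ final_state r h b l).
Proof.
move=> r0; elim: l h b => [|x l IHl] h b hb hb' /=.
  by rewrite /drift big_nil mulr0 addr0.
rewrite drift_cons mulrDr addrA; apply: IHl; rewrite /switch => ->.
  by rewrite eqxx.
by rewrite eqxx; case: eqP => //; lia.
Qed.

(** A visit to an extreme height would make the final state independent of the
    initial one; the parity of [h] then improves the bound by 2. *)
Lemma confined_no_switch r h j l : 0 < r -> h = r - 2 * j -> `|h| < r ->
  confined r h l -> final_state r h true l != final_state r h false l ->
  confined (r - 2) h l.
Proof.
move=> r0; elim: l h j => [|x l IHl] h j hj hr /=; first by lia.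
move=> /andP[_ xl]; rewrite /switch.
set h' := h + _ in xl *; have [//|hr'] := eqVneq h' r; first by rewrite eqxx.
have [//|hr''] := eqVneq h' (- r); first by rewrite eqxx.
have h'r := confined_head xl.
move=> fl; apply/andP; split; first by lia.
apply: (IHl _ (j - step (s x))) => //; first by rewrite /h'; lia.
by lia.
Qed.

(** The entries at which the automaton switches form [c]; they alternate because
    a switch to [true] happens on an upward step and a switch to [false] on a
    downward one.  The height of the remaining walk is the original height
    minus [step] of the current state, which is nearer to 0 at the extreme
    heights, where height and state agree in sign, and by parity is at most
    [r - 1] in absolute value elsewhere. *)
Lemma hysteresis r h b j l : 0 < r -> h = r - 2 * j ->
  (h = r -> b) -> (h = - r -> ~~ b) -> confined r h l ->
  exists c e, [/\ subseq c l, subseq e l, perm_eq l (c ++ e),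
    alternating (~~ b) c /\ confined (r - 1) (h - step b) e
    & final_state r h b l = b (+) odd (size c)].
Proof.
move=> r0; elim: l h b j => [|x l IHl] h b j hj hb hb'.
  move=> /= /andP[hr _]; exists [::], [::]; split=> //=; last by rewrite addbF.
  by split=> //; rewrite andbT; case: b hb hb' => hb hb'; rewrite /step /=; lia.
move=> /=; set h' := h + _ => /andP[hr xl].
have h'r := confined_head xl.
have := IHl h' (switch r b h') (j - step (s x)) _ _ _ xl.
case=> [||| c [e [cl el lce [ac ce] fe]]].
- by rewrite /h'; lia.
- by rewrite /switch => ->; rewrite eqxx.
- by rewrite /switch => ->; rewrite eqxx; case: eqP => //; lia.
have hb1 : `|h - step b| <= r - 1.
  move: hr hj; clear -hb hb' r0; case: (b) hb hb' => hb hb';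
    rewrite /step /=; by lia.
have [same|diff] := eqVneq (switch r b h') b.
  rewrite same in ac ce fe *; exists c, (x :: e); split=> //=.
  - by apply: subseq_trans cl (subseq_cons _ _).
  - by rewrite eqxx.
  - by rewrite perm_sym -cat1s perm_catCA /= perm_cons perm_sym.
  - split=> //; rewrite hb1 /=; move: ce; rewrite /h'.
    by congr confined; rewrite addrAC.
have sxb : s x = ~~ b /\ switch r b h' = ~~ b.
  clear ac ce fe; move: diff; rewrite /switch; have [hr'|_] := eqVneq h' r.
    by move: hr hr'; rewrite /h' /step; case: (b); case: (s x) => //= *; lia.
  have [hr'|_] := eqVneq h' (- r); last by rewrite eqxx.
  by move: hr hr'; rewrite /h' /step; case: (b); case: (s x) => //= *; lia.
move: sxb => [sx sb]; rewrite sb in ac ce fe *.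
exists (x :: c), e; split=> //=.
- by rewrite eqxx.
- by apply: subseq_trans el (subseq_cons _ _).
- by rewrite perm_cons.
- rewrite sx eqxx ac; split=> //; move: ce; rewrite /h' sx.
  by congr confined; clear; case: b; rewrite /step /=; lia.
- by rewrite fe; case: (b); case: odd.
Qed.

(** The walk of [l] ends at the opposite of its starting height, and so must the
    walk of the remainder; this holds when the final state of the automaton is
    opposite to the initial one, which also makes the size of [c] odd.  If
    neither initial state has this property then no extreme height is visited
    and any single entry can be extracted. *)
Lemma extract_alternating (r k : nat) l :
  size l = (r.+1 + 2 * k)%N -> confined r.+1 (- drift l) l ->
  exists b c e (a : nat),
    [/\ subseq c l, subseq e l, perm_eq l (c ++ e),
        alternating b c /\ size c = (2 * a).+1 & confined r (- drift e) e].
Proof.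
move=> sl cl.
have r0 : 0 < r.+1%:Z :> int by lia.
have r1 : r.+1%:Z - 1 = r :> int by lia.
have [j hj] : exists j : int, - drift l = r.+1%:Z - 2 * j.
  exists ((count s l)%:Z - k%:Z); rewrite drift_count.
  by have := count_predC s l; lia.
have odd_half c : odd (size c) -> exists a, size c = (2 * a).+1.
  by move=> o; exists (size c)./2; lia.
have main b : final_state r.+1 (- drift l) b l = ~~ b ->
    (- drift l = r.+1 -> b) -> (- drift l = - (r.+1)%:Z -> ~~ b) ->
  exists b c e (a : nat),
    [/\ subseq c l, subseq e l, perm_eq l (c ++ e),
        alternating b c /\ size c = (2 * a).+1 & confined r (- drift e) e].
  move=> fb hb hb'.
  have [c [e [c1 e1 ce [ac re]]]] := hysteresis r0 hj hb hb' cl.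
  rewrite fb; case oc: (odd (size c)); last by case: (b).
  have [a sa] := odd_half c oc => _.
  exists (~~ b), c, e, a; split=> //.
  move: re; rewrite r1; congr confined.
  rewrite (drift_perm ce) drift_cat (drift_alternating oc ac).
  by case: (b); rewrite /step /=; lia.
have fend b := @final_state_end r.+1 (- drift l) b l r0.
have [hr|hr] := eqVneq (- drift l) r.+1.
  apply: (main true) => //; last by rewrite hr; lia.
  have [//||_ h] := fend true; first by rewrite hr; lia.
  by apply: negbTE; apply: h; lia.
have [hr'|hr'] := eqVneq (- drift l) (- (r.+1)%:Z).
  apply: (main false) => //; last by move/eqP; rewrite (negPf hr).
  have [|//|h _] := fend false; first by move/eqP; rewrite (negPf hr).
  by apply: h; lia.
have hl : `|- drift l| < r.+1.
  by have := confined_head cl; lia.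
have [ft|ft] := boolP (final_state r.+1 (- drift l) true l); last first.
  apply: (main true) => //; first exact: negbTE.
  by move/eqP: hr'.
have [ff|ff] := boolP (final_state r.+1 (- drift l) false l).
  by apply: (main false) => //; move/eqP: hr.
have := confined_no_switch r0 hj hl cl; rewrite ft (negbTE ff) => /(_ isT).
case: l sl {cl hj main fend hr hr' hl ft ff} => [|x l] //= sl /andP[_ cl].
exists (s x), [:: x], l, 0%N; split=> //=.
- by rewrite eqxx sub0seq.
- exact: subseq_cons.
- by rewrite eqxx.
have -> : - drift l = - drift (x :: l) + 2 * step (s x) + - step (s x).
  by rewrite drift_cons; lia.
have -> : r = r.+1%:Z - 2 + 1 :> int by lia.
by apply: confined_shift => //; case: (s x).
Qed.

End Hysteresis.

(** * Divided differences at alternating nodes *)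

Lemma uniq_map_inj_in (I J : eqType) (t : I -> J) c :
  uniq (map t c) -> {in c &, injective t}.
Proof.
elim: c => [|x c IHc] //= /andP[xc uc] i j; rewrite !inE.
move=> /predU1P[->|ic] /predU1P[->|jc] // e; last exact: IHc.
  by move: xc; rewrite e map_f.
by move: xc; rewrite -e map_f.
Qed.

Section DividedDifferences.
Variables (I : eqType).

Definition nodal (F : pzRingType) (t : I -> F) (c : seq I) j :=
  \prod_(i <- c | i != j) (t j - t i).

Lemma nodal_neq0 (F : idomainType) (t : I -> F) c j :
  {in c &, injective t} -> j \in c -> nodal t c j != 0.
Proof.
move=> tI jc; rewrite /nodal prodf_seq_neq0; apply/allP => i ic.
by apply/implyP; apply: contraNneq => /eqP; rewrite subr_eq0 => /eqP /tI ->.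
Qed.

(** The sum is the coefficient of degree [(size c).-1] of the Lagrange
    interpolant of [f] at the nodes, which is [f] itself. *)
Lemma divided_difference0 (F : fieldType) (t : I -> F) c (f : {poly F}) :
  uniq c -> {in c &, injective t} -> (size f < size c)%N ->
  \sum_(j <- c) f.[t j] / nodal t c j = 0.
Proof.
move=> uc tI fc.
pose P j := \prod_(i <- c | i != j) ('X - (t i)%:P).
have sP j : j \in c -> size (P j) = size c.
  move=> jc; rewrite /P -big_filter size_prod_XsubC -rem_filter // size_rem //.
  by case: (c) jc.
have PE j : (P j).[t j] = nodal t c j.
  by rewrite horner_prod; apply: eq_bigr => i _; rewrite !hornerE.
have P0 j i : i \in c -> i != j -> (P j).[t i] = 0.
  move=> ic ij; rewrite horner_prod (big_rem i) //= ij !hornerE subrr mul0r //.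
pose L := \sum_(j <- c) (f.[t j] / nodal t c j) *: P j.
have LE : L = f.
  apply/eqP; rewrite -subr_eq0; apply/eqP.
  apply: (@roots_geq_poly_eq0 _ _ (map t c)).
  - apply/allP => _ /mapP[j jc ->]; rewrite rootE !hornerE /L horner_sum.
    rewrite (big_rem j) //= hornerZ PE divfK ?nodal_neq0 //.
    rewrite big_seq big1 ?addr0 ?subrr // => i.
    rewrite mem_rem_uniq // inE => /andP[ij ic].
    by rewrite hornerZ P0 ?mulr0 // eq_sym.
  - by rewrite map_inj_in_uniq.
  - rewrite size_map (leq_trans (size_polyD _ _)) // size_polyN geq_max.
    rewrite (ltnW fc) andbT /L big_seq; apply: (leq_trans (size_sum _ _ _)).
    apply/bigmax_leqP_seq => j jc _.
    by rewrite (leq_trans (size_scale_leq _ _)) ?sP.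
have : L`_(size c).-1 = 0.
  by rewrite LE nth_default //; case: (size c) fc.
rewrite /L coef_sum => e; rewrite -[RHS]e; apply: eq_big_seq => j jc.
rewrite coefZ -(sP j jc) -lead_coefE.
have /monicP -> : P j \is monic by apply: monic_prod_XsubC.
by rewrite mulr1.
Qed.

Lemma prod_sub_sign (R : realDomainType) (t : I -> R) c (u : R) :
  {in c, forall i, u < t i} -> 0 < (-1) ^+ size c * \prod_(i <- c) (u - t i).
Proof.
elim: c => [|x c IHc] H; first by rewrite big_nil mulr1.
rewrite big_cons exprS mulrACA mulr_gt0 //.
  by rewrite mulN1r opprB subr_gt0 H // mem_head.
by apply: IHc => i ic; rewrite H // inE ic orbT.
Qed.

(** For increasing nodes the sign of [nodal t c j] alternates with [j] and is
    positive at the last node. *)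
Lemma nodal_sign (R : realFieldType) (t : I -> R) (s : I -> bool) b c j :
  sorted (fun i i' => t i < t i') c -> alternating s b c -> j \in c ->
  0 < (-1) ^+ (s j + b + (size c).-1) * nodal t c j.
Proof.
elim: c b => [|x c IHc] b //= xc /andP[/eqP sx ac].
have lt_tr : transitive (fun i i' => t i < t i') by move=> ? ? ?; apply: lt_trans.
have /allP xm := order_path_min lt_tr xc.
rewrite inE => /predU1P[->|jc].
  rewrite /nodal big_cons eqxx /= sx.
  have -> : \prod_(i <- c | i != x) (t x - t i) = \prod_(i <- c) (t x - t i).
    rewrite big_seq_cond [RHS]big_seq_cond; apply: eq_bigl => i.
    by case ic: (i \in c) => //=; apply: contraTneq (xm i ic) => ->; rewrite ltxx.
  have -> : (-1) ^+ (b + b + size c) = (-1) ^+ size c :> R.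
    by rewrite -signr_odd -[in RHS]signr_odd; congr (_ ^+ nat_of_bool _); lia.
  exact: prod_sub_sign.
have /= xj := xm j jc.
rewrite /nodal big_cons.
have -> : x != j by apply: contraTneq xj => ->; rewrite ltxx.
rewrite mulrCA mulr_gt0 ?subr_gt0 //.
have c0 : (0 < size c)%N by case: (c) jc.
have := IHc _ (path_sorted xc) ac jc; congr (_ < _ * _).
by rewrite -signr_odd -[in RHS]signr_odd; congr (_ ^+ nat_of_bool _); lia.
Qed.

End DividedDifferences.

(** * Diagonal forms *)

Section Generic.
Variable R : realFieldType.

(** Bisection: each point of [L] is missed by one half of the interval. *)
Lemma avoid_finite (L : seq R) a b : a < b ->
  exists2 c, a < c < b & c \notin L.
Proof.
elim: L a b => [|x L IHL] a b ab; first by exists ((a + b) / 2) => //; lra.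
have [xm|mx] := ltP x ((a + b) / 2).
  have [|c cab cL] := IHL ((a + b) / 2) b; first by lra.
  exists c; first by lra.
  by rewrite inE negb_or cL andbT; apply/eqP; lra.
have [|c cab cL] := IHL a ((a + b) / 2); first by lra.
exists c; first by lra.
by rewrite inE negb_or cL andbT; apply/eqP; lra.
Qed.

Lemma separate_seqs (X Y L : seq R) : {in X & Y, forall x y, x < y} ->
  exists2 c, c \notin L & {in X, forall x, x < c} /\ {in Y, forall y, c < y}.
Proof.
move=> XY.
have [a Xa aY] : exists2 a, {in X, forall x, x <= a} & {in Y, forall y, a < y}.
  elim: X XY => [|x X IHX] XY.
    elim: Y {XY} => [|y Y [a _ aY]]; first by exists 0.
    exists (Num.min a (y - 1)) => // z; rewrite inE gt_min.
    by case/predU1P => [->|/aY->//]; apply/orP; right; lra.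
  case: IHX => [x' y x'X yY|a Xa aY].
    by apply: XY => //; rewrite inE x'X orbT.
  exists (Num.max a x) => z.
    by rewrite inE le_max => /predU1P[->|/Xa->//]; rewrite lexx orbT.
  by move=> zY; rewrite gt_max aY // XY // mem_head.
have [b ab bY] : exists2 b, a < b & {in Y, forall y, b <= y}.
  elim: Y aY {XY} => [|y Y IHY] aY; first by exists (a + 1) => //; lra.
  case: IHY => [z zY|b ab bY]; first by apply: aY; rewrite inE zY orbT.
  exists (Num.min b y); first by rewrite lt_min ab aY ?mem_head.
  by move=> z; rewrite inE ge_min => /predU1P[->|/bY->//]; rewrite lexx orbT.
have [c /andP[ac cb] cL] := avoid_finite L ab.
exists c => //; split=> z zX; first exact: le_lt_trans (Xa z zX) ac.
exact: lt_le_trans cb (bY z zX).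
Qed.

End Generic.

Lemma sub_in_count (I : eqType) (P Q : pred I) l :
  {in l, subpred P Q} -> (count P l <= count Q l)%N.
Proof.
elim: l => //= x l IHl PQ; apply: leq_add.
  by have := PQ x (mem_head _ _); case: (P x) (Q x) => // [] [] // /(_ isT).
by apply: IHl => y yl; apply: PQ; rewrite inE yl orbT.
Qed.

Section DiagonalForms.
Local Open Scope complex_scope.
Variable R : rcfType.
Local Notation C := R[i].
Variables (n : nat) (d : 'rV[C]_n).

Lemma real_complexM (x y : R) : (x * y)%:C = x%:C * y%:C.
Proof. exact: rmorphM. Qed.

Lemma real_complexXn (x : R) m : (x ^+ m)%:C = x%:C ^+ m.
Proof. exact: rmorphXn. Qed.

Definition slope j : R := complex.Im (d 0 j) / complex.Re (d 0 j).
Definition rightside j : bool := 0 < complex.Re (d 0 j).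

Definition supported k (l : seq 'I_n) (X : 'M[C]_(k, n)) :=
  forall i j, j \notin l -> X i j = 0.

Lemma neutral_union k1 k2 c e (X1 : 'M_(k1, n)) (X2 : 'M_(k2, n)) :
  {in c, forall j, j \notin e} ->
  supported c X1 -> neutral (diag_mx d) X1 ->
  supported e X2 -> neutral (diag_mx d) X2 ->
  supported (c ++ e) (col_mx X1 X2) /\ neutral (diag_mx d) (col_mx X1 X2).
Proof.
move=> ce s1 [f1 n1] s2 [f2 n2]; split.
  move=> i j; rewrite mem_cat negb_or => /andP[jc je]; rewrite mxE.
  by case: split => i'; [rewrite s1|rewrite s2].
have cross i i' j : X1 i j = 0 \/ X2 i' j = 0.
  have [jc|jc] := boolP (j \in c); last by left; apply: s1.
  by right; apply: s2; apply: ce.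
split.
  apply: inj_row_free => u; rewrite -[u]hsubmxK mul_row_col => e0.
  have u1 : lsubmx u *m X1 = 0.
    apply/matrixP => i j; rewrite [RHS]mxE.
    have [jc|jc] := boolP (j \in c); last first.
      by rewrite mxE big1 // => l _; rewrite s1 // mulr0.
    move/matrixP/(_ i j): e0; rewrite mxE [X in _ + X]mxE [RHS]mxE.
    by rewrite [X in _ + X]big1 ?addr0 // => l _; rewrite s2 ?mulr0 // ce.
  move: e0; rewrite u1 add0r => u2.
  have -> : lsubmx u = 0 by apply: (row_free_inj f1); rewrite u1 mul0mx.
  have -> : rsubmx u = 0 by apply: (row_free_inj f2); rewrite u2 mul0mx.
  by rewrite row_mx0.
have X12 : X1 *m diag_mx d *m X2 ^t* = 0.
  apply/matrixP => i i'; rewrite mul_mx_diag mxE [RHS]mxE big1 // => j _.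
  rewrite mxE adjmxE; case: (cross i i' j) => ->; first by rewrite !mul0r.
  by rewrite conjC0 mulr0.
rewrite congr_col_mx n1 n2 X12.
have -> : X2 *m diag_mx d *m X1 ^t* = 0; last exact: block_mx0.
apply/matrixP => i' i; rewrite mul_mx_diag mxE [RHS]mxE big1 // => j _.
rewrite mxE adjmxE; case: (cross i i' j) => ->; first by rewrite conjC0 mulr0.
by rewrite !mul0r.
Qed.

Lemma neutral_usub k e l (X : 'M_(k + e, n)) :
  supported l X -> neutral (diag_mx d) X ->
  supported l (usubmx X) /\ neutral (diag_mx d) (usubmx X).
Proof.
move=> sX [fX nX]; split; first by move=> i j jl; rewrite mxE sX.
split.
  apply: inj_row_free => u uX.
  have : row_mx u 0 *m X = 0.
    by rewrite -[X in _ *m X]vsubmxK mul_row_col uX mul0mx addr0.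
  rewrite -(mul0mx _ X) => /(row_free_inj fX); rewrite -row_mx0.
  by case/eq_row_mx.
move: nX; rewrite -[X]vsubmxK congr_col_mx => /(congr1 ulsubmx).
by rewrite block_mxKul vsubmxK => ->; apply/matrixP => i j; rewrite !mxE.
Qed.

Hypothesis Red0 : forall j, complex.Re (d 0 j) != 0.

Lemma rightsideN j : ~~ rightside j -> complex.Re (d 0 j) < 0.
Proof. by rewrite -leNgt lt_neqAle Red0. Qed.

(** The weights [w j] solve [w j ^+ 2 * Re (d 0 j) = +- 1 / nodal t c j], which is
    possible since both sides alternate in sign; then the entries of the form
    on the vectors [(w j * t j ^+ l)_j] are divided differences of the
    polynomials ['X^(l + m)] and ['X^(l + m).+1].  These vectors are independent,
    as a polynomial of degree less than [a] vanishes at no more than [a] nodes. *)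
Lemma neutral_chain a b c :
  sorted (fun i j => slope i < slope j) c -> alternating rightside b c ->
  size c = (2 * a).+1 ->
  exists X : 'M[C]_(a, n), supported c X /\ neutral (diag_mx d) X.
Proof.
move=> sc ac size_c; set t := slope in sc; set s := rightside in ac.
have tuniq : uniq (map t c).
  by apply: (@sorted_uniq _ <%R);
    [exact: lt_trans | exact: ltxx | rewrite sorted_map].
have tI : {in c &, injective t} by apply: uniq_map_inj_in.
have uc : uniq c by apply: map_uniq tuniq.
pose om j := nodal t c j.
pose kap : R := (-1) ^+ ~~ b.
pose p j := complex.Re (d 0 j).
have om0 j : j \in c -> om j != 0 by apply: nodal_neq0.
have pos j : j \in c -> 0 < kap / (p j * om j).
  move=> jc; have := nodal_sign sc ac jc; rewrite size_c /=.
  have -> : (-1) ^+ (s j + b + 2 * a) = (-1) ^+ s j * (-1) ^+ b :> R.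
    rewrite -signr_odd -exprD -[in RHS]signr_odd.
    by congr (_ ^+ nat_of_bool _); lia.
  rewrite -/(om j) => H.
  have : 0 < kap * (p j * om j).
    move: H; rewrite /kap /s /rightside -/(p j).
    have [pj|pj|/eqP pj] := ltrgt0P (p j); last by rewrite (negPf (Red0 j)) in pj.
      by case: (b); rewrite /= ?expr0 ?expr1; nra.
    by case: (b); rewrite /= ?expr0 ?expr1; nra.
  have q0 : p j * om j != 0 by rewrite mulf_neq0 ?om0 //; apply: Red0.
  have -> : kap / (p j * om j) = kap * (p j * om j) * (p j * om j)^-1 ^+ 2.
    by rewrite expr2 [RHS]mulrA mulfK.
  by move=> kq; rewrite mulr_gt0 // exprn_even_gt0 // invr_eq0.
pose w j := Num.sqrt (kap / (p j * om j)).
have ww j : j \in c -> w j ^+ 2 * p j = kap / om j.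
  move=> jc; rewrite sqr_sqrtr ?ltW ?pos //.
  have p0 : p j != 0 by apply: Red0.
  by have o0 := om0 j jc; field; rewrite p0 o0.
have w0 j : j \in c -> w j != 0.
  by move=> jc; rewrite sqrtr_eq0 -ltNge pos.
pose X : 'M[C]_(a, n) :=
  \matrix_(l, j) if j \in c then (w j * t j ^+ l)%:C else 0.
exists X; split; first by move=> l j jc; rewrite mxE (negPf jc).
split.
  apply: inj_row_free => u uX.
  have : rVpoly u = 0.
    apply: (@roots_geq_poly_eq0 _ _ (map (fun j => (t j)%:C) c)).
    - apply/allP => _ /mapP[j jc ->]; rewrite rootE.
      have := congr1 (fun M : 'rV_n => M 0 j) uX; rewrite !mxE => e.
      have : (w j)%:C * (rVpoly u).[(t j)%:C] = 0.
        rewrite -[RHS]e (horner_coef_wide _ (size_poly _ _)) mulr_sumr.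
        apply: eq_bigr => l _; rewrite coef_rVpoly_ord mxE jc.
        by rewrite (real_complexM (w j)) real_complexXn; ring.
      by move=> /eqP; rewrite mulf_eq0 fmorph_eq0 (negPf (w0 j jc)).
    - rewrite (map_comp (real_complex R)) map_inj_uniq //; exact: complexI.
    - by rewrite size_map size_c; apply: leq_trans (size_poly _ _) _; lia.
  by move=> e; apply/rowP => l; rewrite -coef_rVpoly_ord e coef0 mxE.
have moment m : (m < 2 * a)%N -> \sum_(j <- c) (w j ^+ 2 * p j) * t j ^+ m = 0.
  move=> ma; rewrite (eq_big_seq (fun j => kap * ('X^m.[t j] / om j))).
    by rewrite -mulr_sumr divided_difference0 ?mulr0 // size_polyXn size_c; lia.
  by move=> j jc; rewrite ww // hornerXn; ring.
apply/matrixP => l m; rewrite mul_mx_diag mxE [RHS]mxE.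
rewrite (bigID (mem c)) /= addrC big1 ?add0r; last first.
  by move=> j jc; rewrite !mxE (negPf jc) !mul0r.
rewrite -big_uniq //.
rewrite (eq_big_seq (fun j => (w j ^+ 2 * p j * t j ^+ (l + m))%:C +
  'i%C * (w j ^+ 2 * p j * t j ^+ (l + m).+1)%:C)).
  have [lm1 lm2] : (l + m < 2 * a)%N /\ ((l + m).+1 < 2 * a)%N.
    by have := ltn_ord l; have := ltn_ord m; lia.
  rewrite big_split /= -mulr_sumr -!rmorph_sum !moment ?lm1 ?lm2 //.
  by rewrite mulr0 addr0.

move=> j jc; rewrite adjmxE !mxE jc conj_Creal; last first.
  by apply/complex_realP; exists (w j * t j ^+ m).
have pt : complex.Im (d 0 j) = p j * t j by rewrite /t /slope mulrC divfK.
have -> : d 0 j = (p j)%:C + 'i%C * (p j * t j)%:C by rewrite -pt -complexE.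
move: (t j) (p j) (w j) => tj pj wj.
by rewrite !real_complexM !real_complexXn exprS exprD; ring: (sqr_i R).
Qed.

Hypothesis no_opposite : forall i j,
  rightside i -> ~~ rightside j -> slope i != slope j.

(** Equal slopes of consecutive entries on different sides would make the
    entries opposite. *)
Lemma alternating_sorted b c : alternating rightside b c ->
  sorted (fun i j => slope i <= slope j) c ->
  sorted (fun i j => slope i < slope j) c.
Proof.
elim: c b => [|x [|y c] IHc] b //= /and3P[/eqP sx /eqP sy ac] /andP[xy yc].
apply/andP; split; last by apply: (IHc (~~ b)) => //=; rewrite sy eqxx ac.
rewrite lt_neqAle xy andbT; case: b sx sy {ac} => sx sy.
  by apply: no_opposite; rewrite ?sx ?sy.
by rewrite eq_sym; apply: no_opposite; rewrite ?sx ?sy.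
Qed.

(** Induction on [r]: split off one alternating sublist, and add its neutral
    subspace to that of the remainder. *)
Lemma neutral_confined (r k : nat) l :
  uniq l -> sorted (fun i j => slope i <= slope j) l -> size l = (r + 2 * k)%N ->
  confined rightside r (- drift rightside l) l ->
  exists X : 'M[C]_(k, n), supported l X /\ neutral (diag_mx d) X.
Proof.
have le_tr : transitive (fun i j => slope i <= slope j).
  by move=> ? ? ?; apply: le_trans.
elim: r k l => [|r IHr] k l ul sl szl cl.
  have l0 : l = [::].
    case: l cl {ul sl szl} => //= x l /andP[h0 /confined_head h1]; move: h0 h1.
    by rewrite drift_cons /step; case: (rightside x); lia.
  have k0 : k = 0%N by move: szl; rewrite l0 /=; lia.
  subst k; exists 0; split; first by move=> [].
  by split; [rewrite /row_free mxrank0 | apply/matrixP => -[]].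
have [b [c [e [a [c1 e1 pl [ac sc] ce]]]]] := extract_alternating szl cl.
have sorted_c := alternating_sorted ac (subseq_sorted le_tr c1 sl).
have supp_l m (Z : 'M_(m, n)) : supported (c ++ e) Z -> supported l Z.
  by move=> Zs i j jl; apply: Zs; rewrite -(perm_mem pl).
have [ka|/ltnW ak] := leqP k a.
  have [m am] : exists m, a = (k + m)%N by exists (a - k)%N; rewrite subnKC.
  subst a; have [X [Xs Xn]] := neutral_chain sorted_c ac sc.
  have [Ys Yn] := neutral_usub Xs Xn.
  exists (usubmx X); split=> //; apply: supp_l => i j.
  by rewrite mem_cat negb_or => /andP[jc _]; apply: Ys.
have [m km] : exists m, k = (a + m)%N by exists (k - a)%N; rewrite subnKC.
subst k; have [X [Xs Xn]] := neutral_chain sorted_c ac sc.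
have sze : size e = (r + 2 * m)%N.
  by move: szl; rewrite (perm_size pl) size_cat sc; clear; lia.
have [Y [Ys Yn]] :=
  IHr m e (subseq_uniq e1 ul) (subseq_sorted le_tr e1 sl) sze ce.
have ce0 : {in c, forall j, j \notin e}.
  move: ul; rewrite (perm_uniq pl) cat_uniq => /and3P[_ /hasPn ec _] j jc.
  by apply: contraL jc => /ec.
have [XYs XYn] := neutral_union ce0 Xs Xn Ys Yn.
by exists (col_mx X Y); split=> //; apply: supp_l.
Qed.

(** The directions [w = c + i] and [- w]: the real part of [w * d 0 j] is
    [Re (d 0 j) * (c - slope j)]. *)
Lemma half_plane_count B k : inertia_bound B (diag_mx d) k ->
  exists L : seq R, forall c, c \notin L ->
    (#|[set j : 'I_n | (complex.Re (d 0 j) * (c - slope j) < 0)%R]| + k <= n)%N /\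
    (#|[set j : 'I_n | (0 < complex.Re (d 0 j) * (c - slope j))%R]| + k <= n)%N.
Proof.
move=> QD.
pose bad (b : C) : R := complex.Re ('i%C * (b - 1) / (1 + b)).
exists (map bad B) => c cL.
pose w : C := c%:C + 'i%C.
have conj_w : w^*%R = c%:C - 'i%C.
  rewrite rmorphD /= conj_Creal; last by apply/complex_realP; exists c.
  by rewrite complexiE conjCi.
have wB b : b \in B -> w + w^*%R * b != 0.
  move=> bB; apply: contraNneq cL => e.
  have i0 : 'i%C != 0 :> C by rewrite complexiE neq0Ci.
  have b1 : 1 + b != 0.
    apply: contra_eq_neq e => b1.
    have -> : b = -1 by apply/eqP; rewrite -addr_eq0 addrC b1.
    have -> : w + w^*%R * -1 = 'i%C *+ 2 by rewrite conj_w /w; ring.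
    by rewrite mulrn_eq0.
  apply/mapP; exists b => //; rewrite /bad.
  suff -> : 'i%C * (b - 1) / (1 + b) = c%:C by [].
  apply: (mulIf b1); rewrite divfK //; apply/eqP; rewrite -subr_eq0 -oppr_eq0.
  by apply/eqP; rewrite -e conj_w /w; ring.
have w0 : w != 0.
  apply/eqP => /(congr1 (@complex.Im R)) /= /eqP.
  by rewrite add0r oner_eq0.
have val j : w * d 0 j + (w * d 0 j)^*%R =
    (2 * (complex.Re (d 0 j) * (c - slope j)))%:C.
  have -> : complex.Re (d 0 j) * (c - slope j) =
      complex.Re (d 0 j) * c - complex.Im (d 0 j).
    by rewrite mulrBr [_ * slope j]mulrC divfK.
  rewrite -[_^*%R]/(_^*%C) addcJ (rmorphM (real_complex R)) rmorph_nat.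
  congr (_ * _%:C); rewrite /w; case: (d 0 j) => p q /=; ring.
split.
  have := inertia_bound_diag QD w0 wB; congr (_ + _ <= _)%N.
  by apply: eq_card => j; rewrite !inE val ltcR; apply/idP/idP; lra.
have Nw0 : - w != 0 by rewrite oppr_eq0.
have NwB b : b \in B -> - w + (- w)^*%R * b != 0.
  by move=> /wB; rewrite rmorphN mulNr -opprD oppr_eq0.
have := inertia_bound_diag QD Nw0 NwB; congr (_ + _ <= _)%N.
apply: eq_card => j; rewrite !inE mulNr rmorphN -opprD val oppr_lt0 ltcR.
by apply/idP/idP; lra.
Qed.

(** Each cut [l1 ++ l2] of the sorted list is realized by a half-plane with [c]
    avoiding [L], up to entries whose slope equals that at the cut; as
    opposite entries are excluded, such ties have equal signs, and [c] can be
    chosen on the side that makes the count of the half-plane dominate that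
    of the cut. *)
Lemma neutral_diag B k : inertia_bound B (diag_mx d) k ->
  exists X : 'M[C]_(k, n), neutral (diag_mx d) X.
Proof.
move=> /half_plane_count[L count_L].
pose l := sort (fun i j => slope i <= slope j) (enum 'I_n).
have pl : perm_eq l (enum 'I_n) by apply/permPl/perm_sort.
have sl : sorted (fun i j => slope i <= slope j) l.
  by apply: sort_sorted => i j; apply: le_total.
have ul : uniq l by rewrite (perm_uniq pl) enum_uniq.
have szl : size l = n by rewrite (perm_size pl) size_enum_ord.
have count_card (P : pred 'I_n) : count P l = #|[set j : 'I_n | P j]|.
  rewrite cardsE cardE /enum_mem size_filter -enumT (permP pl).
  by apply: eq_count => j.
have le_tr : transitive (fun i j => slope i <= slope j).
  by move=> ? ? ?; apply: le_trans.
have split_bound l1 l2 : l = l1 ++ l2 ->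
  (count rightside l1 + count (predC rightside) l2 + k <= n)%N /\
  (count (predC rightside) l1 + count rightside l2 + k <= n)%N.
  move=> el.
  have l12 i j : i \in l1 -> j \in l2 -> slope i <= slope j.
    move: sl; rewrite el sorted_pairwise // pairwise_cat.
    by move=> /and3P[/allrelP H _ _]; apply: H.
  have cut (s : pred 'I_n) : (forall i j, s i -> ~~ s j -> slope i != slope j) ->
    exists2 c, c \notin L & {in l1, forall j, s j -> slope j < c} /\
      {in l2, forall j, ~~ s j -> c < slope j}.
    move=> sd; have [|c cL [c1 c2]] := @separate_seqs R
      (map slope (filter s l1)) (map slope (filter (predC s) l2)) L.
      move=> _ _ /mapP[i + ->] /mapP[j + ->]; rewrite !mem_filter /=.
      by move=> /andP[si il] /andP[sj jl]; rewrite lt_neqAle sd // l12.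
    exists c => //; split=> j jl sj; [apply: c1|apply: c2];
      by rewrite map_f // mem_filter /= sj.
  have cat_count (s P : pred 'I_n) : {in l1, subpred s P} ->
      {in l2, subpred (predC s) P} ->
      (count s l1 + count (predC s) l2 <= #|[set j : 'I_n | P j]|)%N.
    move=> H1 H2; rewrite -count_card el count_cat.
    by apply: leq_add; apply: sub_in_count.
  split.
    have [c /count_L[_ +] [c1 c2]] := cut rightside no_opposite.
    apply: leq_trans; rewrite leq_add2r; apply: cat_count => j jl sj.
      by rewrite /= mulr_gt0 // subr_gt0 c1.
    have pj : complex.Re (d 0 j) < 0 by apply: rightsideN.
    by rewrite /= nmulr_rgt0 // subr_lt0 c2.
  have [|c /count_L[+ _] [c1 c2]] := cut (predC rightside).
    by move=> i j /= si; rewrite negbK => sj; rewrite eq_sym no_opposite.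
  apply: leq_trans; rewrite leq_add2r.
  have -> : count rightside l2 = count (predC (predC rightside)) l2.
    by apply: eq_count => j /=; rewrite negbK.
  apply: cat_count => j jl sj.
    have pj : complex.Re (d 0 j) < 0 by apply: rightsideN.
    by rewrite /= nmulr_rlt0 // subr_gt0 c1.
  have pj : 0 < complex.Re (d 0 j) by move: sj; rewrite /= negbK.
  by rewrite /= pmulr_rlt0 // subr_lt0 c2.
have kn : (2 * k <= n)%N.
  have [] := split_bound [::] l erefl; rewrite /= => h1 h2.
  by have := count_predC rightside l; rewrite szl; lia.
have [||X [_ Xn]] := @neutral_confined (n - 2 * k)%N k l ul sl; last by exists X.
  by rewrite szl subnK.
apply: confined_prefix => l1 l2 el; have [h1 h2] := split_bound _ _ el.
rewrite el !drift_count !count_cat.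
have := count_predC rightside l1; have := count_predC rightside l2.
move: szl h1 h2 kn; rewrite el size_cat; clear.
move: (count rightside l1) (count (predC rightside) l1) => p1 q1.
move: (count rightside l2) (count (predC rightside) l2) => p2 q2.
lia.
Qed.

End DiagonalForms.

(** * Neutral subspaces from inertia bounds *)

Section Main.
Variable R : rcfType.
Local Notation C := R[i].

Lemma opposite_ratio n (d : 'rV[C]_n) i j : complex.Re (d 0 i) != 0 ->
  complex.Re (d 0 j) != 0 -> rightside d i -> ~~ rightside d j ->
  slope d i = slope d j -> d 0 i / d 0 j < 0.
Proof.
move=> ri rj si sj; rewrite /slope => e.
have pi : 0 < complex.Re (d 0 i) by [].
have pj : complex.Re (d 0 j) < 0 by rewrite lt_neqAle rj leNgt.
pose t := complex.Im (d 0 j) / complex.Re (d 0 j).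
have dE l : complex.Re (d 0 l) != 0 ->
    complex.Im (d 0 l) / complex.Re (d 0 l) = t ->
    d 0 l = (real_complex R (complex.Re (d 0 l))) * (Complex 1 t).
  move=> rl tl; have : complex.Im (d 0 l) = t * complex.Re (d 0 l).
    by rewrite -tl divfK.
  case: (d 0 l) => p q /= ->; apply/eqP; rewrite eq_complex /=.
  by apply/andP; split; apply/eqP; ring.
have t0 : Complex 1 t != 0 by rewrite eq_complex /= oner_eq0.
rewrite (dE i) // (dE j) // invfM mulrACA mulfV // mulr1.
by rewrite -fmorphV -rmorphM /= ltcR pmulr_rlt0 // invr_lt0.
Qed.

Theorem neutral_of_inertia n (A : 'M[C]_n) B k :
  inertia_bound B A k -> exists X : 'M[C]_(k, n), neutral A X.
Proof.
elim/ltn_ind: n => n IHn in A B k *; case: k => [|k] QA.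
  exists 0; split; first by rewrite /row_free mxrank0.
  by apply/matrixP => -[].
have IH m : (m < n)%N -> forall (A' : 'M[C]_m) B', inertia_bound B' A' k ->
     exists X : 'M[C]_(k, m), neutral A' X.
  by move=> mn A' B'; apply: IHn.
have [[x [mu xA]]|[P [d [Pf Pd]]]] := isotropic_eigenvector_or_diag A.
  exact: neutral_reduction QA xA IH.
have [[x [mu xA]]|nA] := EM (exists x mu, isotropic_eigenvector (diag_mx d) x mu).
  apply: (neutral_reduction QA _ IH); apply: (isotropic_eigenvector_congr Pf).
  by rewrite Pd; exact: xA.
have d0 j : d 0 j != 0.
  apply/eqP => dj; apply: nA; exists (delta_mx 0 j), 0.
  exact: isotropic_eigenvector_diag0.
have dopp i j : ~~ (d 0 i / d 0 j < 0).
  by apply/negP => /isotropic_eigenvector_diag_opp.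
(* w d_j is purely imaginary only when c is the slope of d_j *)
have [c _ cL] := avoid_finite (map (slope d) (enum 'I_n)) (@ltr01 R).
pose w : C := Complex c 1.
have w0 : w != 0 by rewrite eq_complex /= oner_eq0 andbF.
pose d' : 'rV[C]_n := w *: d.
have Red' j : complex.Re (d' 0 j) != 0.
  rewrite mxE; move: (d0 j) cL; case dj: (d 0 j) => [p q].
  rewrite eq_complex /= => pq cL.
  apply: contra cL; rewrite mul1r subr_eq0 => /eqP cp.
  have p0 : p != 0.
    by apply: contraNneq pq => p0; rewrite -cp p0 mulr0 eqxx.
  apply/mapP; exists j; first by rewrite mem_enum.
  by rewrite /slope dj /= -cp mulfK.
have d'opp i j : rightside d' i -> ~~ rightside d' j -> slope d' i != slope d' j.
  move=> si sj; apply: contra (dopp i j) => /eqP.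
  move=> /(opposite_ratio (Red' i) (Red' j) si sj).
  by rewrite !mxE invfM mulrACA mulfV // mul1r.
have := inertia_bound_compression (P := P) QA w0 (leqnn n).
rewrite Pd -linearZ => /(neutral_diag Red' d'opp)[X [Xf X0]].
exists (X *m P); apply: (neutral_congr Pf); rewrite Pd.
split; [exact: Xf|]; apply/eqP; move/eqP: X0.
by rewrite linearZ -scalemxAr -scalemxAl scaler_eq0 (negPf w0).
Qed.

End Main.

(** * Numerical ranges *)

Local Open Scope classical_set_scope.

Lemma compression_numrange_isometry (R : realType) n m (A : 'M[R[i]]_n) M :
  isometries R n m M ->
  compression_numrange (M *m M ^t*) A = numrange (M ^t* *m A *m M).
Proof.
rewrite /isometries /= => MM; apply/seteqP; split=> z [x].
  move=> /= [Px xx] <-; exists (M ^t* *m x).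
    by rewrite /= adjmxM trmxCK -mulmxA [M *m _]mulmxA Px.
  rewrite adjmxM trmxCK !mulmxA.
  have Pxs : x ^t* *m M *m M ^t* = x ^t*.
    by rewrite -[in RHS]Px !adjmxM trmxCK mulmxA.
  by rewrite Pxs -!mulmxA [M *m (_ *m _)]mulmxA Px.
move=> /= xx <-; exists (M *m x); last by rewrite adjmxM !mulmxA.
split; first by rewrite -mulmxA [_ *m (M *m x)]mulmxA MM mul1mx.
by rewrite adjmxM -mulmxA [_ *m (M *m x)]mulmxA MM mul1mx.
Qed.

(** The ranges of [X] and [M] meet by dimension, and a common unit vector gives
    the value [lam] to both compressions. *)
Lemma rank_numrange_sub (R : realType) n k m (A : 'M[R[i]]_n) M :
  (n < k + m)%N -> isometries R n m M ->
  rank_numrange k A `<=` numrange (M ^t* *m A *m M).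
Proof.
rewrite /isometries /= => nkm MM lam [X XX XAX].
have XX' : X ^t* *m X = 1%:M by [].
have rk j (Y : 'M[R[i]]_(n, j)) : Y ^t* *m Y = 1%:M -> \rank (Y ^t*) = j.
  by move=> YY; apply: mxrank_unitary; apply/unitarymxP; rewrite trmxCK.
have : (X ^t* :&: M ^t*)%MS != 0.
  rewrite -mxrank_eq0 -lt0n -(ltn_add2l (\rank (X ^t* + M ^t*)%MS)) addn0.
  rewrite mxrank_sum_cap !rk //; apply: leq_ltn_trans nkm; exact: rank_leq_col.
move=> /rowV0Pn[v + v0]; rewrite sub_capmx => /andP[/submxP[a va] /submxP[b vb]].
have [c] := exists_unit v0; set u := c *: v => uu.
have ua : u = (c *: a) *m X ^t* by rewrite /u va scalemxAl.
have ub : u = (c *: b) *m M ^t* by rewrite /u vb scalemxAl.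
have red j (Y : 'M[R[i]]_(n, j)) (e : 'rV_j) : Y ^t* *m Y = 1%:M ->
    u = e *m Y ^t* -> e *m e ^t* = 1%:M.
  move=> YY ue; rewrite -uu ue adjmxM trmxCK -mulmxA [_ ^t* *m (_ *m _)]mulmxA.
  by rewrite YY mul1mx.
exists ((c *: b) ^t*); first by rewrite /= trmxCK (red _ _ _ MM ub).
have -> : (c *: b)^t*^t* *m (M^t* *m A *m M) *m (c *: b)^t* = u *m A *m u ^t*.
  by rewrite trmxCK {1 2}ub adjmxM trmxCK !mulmxA.
rewrite {1 2}ua adjmxM trmxCK.
have -> : c *: a *m X^t* *m A *m (X *m (c *: a)^t*) =
          c *: a *m (X ^t* *m A *m X) *m (c *: a) ^t* by rewrite !mulmxA.
rewrite XAX mul_mx_scalar -scalemxAl (red _ _ _ XX' ua) scalemx1.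
by rewrite mxE eqxx mulr1n.
Qed.

(** A negative definite subspace of dimension greater than [n - k] contains the
    range of an isometry with [n - k + 1] columns, hence a unit vector at which
    the form of [A - lam%:M] vanishes. *)
Lemma inertia_bound_numrange (R : realType) n k (A : 'M[R[i]]_n) lam :
  (k <= n)%N ->
  (forall M, isometries R n (n - k + 1) M -> numrange (M ^t* *m A *m M) lam) ->
  inertia_bound [::] (A - lam%:M) k.
Proof.
move=> kn H w w0 _ m U Un; rewrite leqNgt; apply/negP => nmk.
have Uf := negdef_free Un.
have mn : (m <= n)%N by rewrite -(eqP Uf) rank_leq_col.
have le_m : (n - k + 1 <= m)%N by lia.
have Zu := schmidt_unitarymx U mn.
pose N := rowsub (widen_ord le_m) (schmidt U).
have NN : N *m N ^t* = 1%:M.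
  apply/matrixP => i j; have /unitarymxP/matrixP := Zu.
  move=> /(_ (widen_ord le_m i) (widen_ord le_m j)).
  rewrite !mxE => e; rewrite -(inj_eq val_inj) /= in e *; rewrite -e.
  by apply: eq_bigr => l _; rewrite !mxE.
have [|x /= xx xv] := H (N ^t*); first by rewrite /isometries /= trmxCK.
pose u := x ^t* *m N.
have uu : u *m u ^t* = 1%:M.
  by rewrite adjmxM trmxCK -mulmxA [N *m _]mulmxA NN mul1mx.
have uAu : u *m (A - lam%:M) *m u ^t* = 0.
  rewrite mulmxBr mulmxBl mul_mx_scalar -scalemxAl uu.
  have -> : u *m A *m u ^t* = x^t* *m (N^t*^t* *m A *m N^t*) *m x.
    by rewrite adjmxM !trmxCK !mulmxA.
  by rewrite [X in X - _]mx11_scalar xv scalemx1 subrr.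
have /submxP[e ue] : (u <= U)%MS.
  apply: submx_trans (submxMl _ _) _.
  have := eqmx_schmidt_free Uf; move=> <-.
  by rewrite /N rowsubE submxMl.
have e0 : e != 0.
  apply/eqP => e0; move: uu; rewrite ue e0 !mul0mx => /matrixP/(_ 0 0).
  by rewrite !mxE eqxx => /eqP; rewrite eq_sym oner_eq0.
by have := Un e e0; rewrite -ue hpart_neutral // mxE ltxx.
Qed.

Lemma neutral_rank_numrange (R : realType) n k (A : 'M[R[i]]_n) lam X :
  (k <= n)%N -> neutral (A - lam%:M) (X : 'M[R[i]]_(k, n)) ->
  rank_numrange k A lam.
Proof.
move=> kn [Xf X0].
have Zu : schmidt X \is unitarymx by apply: schmidt_unitarymx.
have /submxP[T ZE] : (schmidt X <= X)%MS by rewrite (eqmx_schmidt_free Xf).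
have /unitarymxP ZZ := Zu.
exists ((schmidt X) ^t*); first by rewrite /isometries /= trmxCK.
rewrite trmxCK; have : schmidt X *m (A - lam%:M) *m (schmidt X) ^t* = 0.
  rewrite ZE adjmxM.
  have -> : T *m X *m (A - lam%:M) *m (X ^t* *m T ^t*) =
      T *m (X *m (A - lam%:M) *m X ^t*) *m T ^t* by rewrite !mulmxA.
  by rewrite X0 mulmx0 mul0mx.
rewrite mulmxBr mulmxBl mul_mx_scalar -scalemxAl ZZ scalemx1.
by move/eqP; rewrite subr_eq0 => /eqP.
Qed.

Theorem theorem2p1 (R : realType) (n k : nat) (hk : (1 <= k <= n)%N)
    (A : 'M[R[i]]_n) :
  rank_numrange k A
    = \bigcap_(M in isometries R n (n - k + 1)) numrange (M ^t* *m A *m M) /\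
  \bigcap_(M in isometries R n (n - k + 1)) numrange (M ^t* *m A *m M)
    = \bigcap_(P in orthoprojs R n (n - k + 1)) compression_numrange P A.
Proof.
have /andP[k1 kn] := hk; split; apply/seteqP; split.
- move=> lam lamA M MM; apply: (rank_numrange_sub _ MM lamA); lia.
- move=> lam H; have [X Xn] := neutral_of_inertia (inertia_bound_numrange kn H).
  exact: neutral_rank_numrange Xn.
- move=> lam H P [M MM <-].
  by rewrite compression_numrange_isometry //; apply: H.
- move=> lam H M MM; rewrite -compression_numrange_isometry //.
  by apply: H; exists M.
Qed.
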